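(* Let $\mathbf{A}$ be a finite loop. Then $\mathbb{V}(\mathbf{A})$ has at most countably many subvarieties, and all of them are finitely generated.
   Context: A loop is regarded as an algebra $(A, \cdot, \backslash, /, 1)$, where $(A,\cdot,\backslash,/)$ is a quasigroup (i.e. $x \backslash (x\cdot y) = y$, $x \cdot (x \backslash y) = y$, $(y \cdot x)/x = y$, $(y/x)\cdot x = y$ for all $x,y$) and $1$ is a two-sided identity element for $\cdot$. A variety is a class of algebras of a fixed type that consists of all algebras of this type satisfying some (possibly infinite) set of identities. For an algebra $\mathbf{A}$, $\mathbb{V}(\mathbf{A})$ denotes the smallest variety containing $\mathbf{A}$, i.e. the class of all algebras of the same type that satisfy all identities satisfied by $\mathbf{A}$. A subvariety of $V$ is a variety (of the same type) contained in $V$. A variety $V$ is finitely generated if $V = \mathbb{V}(\mathbf{B})$ for some finite algebra $\mathbf{B}$. *)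

(* Defs.v *)
From mathcomp Require Import all_boot.
From mathcomp Require Import boolp classical_sets functions cardinality.

Set Implicit Arguments.
Unset Strict Implicit.
Unset Printing Implicit Defensive.

Local Open Scope classical_set_scope.

(* Algebras of type (2, 2, 2, 0): no axioms are imposed on the operations.
   A class of such algebras is a [set algebra]. *)
Record algebra := Algebra {
  carrier :> Type;
  mul : carrier -> carrier -> carrier;
  ldiv : carrier -> carrier -> carrier;  (* ldiv x y is x \ y *)
  rdiv : carrier -> carrier -> carrier;  (* rdiv x y is x / y *)
  one : carrier
}.

Arguments one : clear implicits.

Definition is_quasigroup (A : algebra) : Prop :=
  [/\ forall x y : A, ldiv x (mul x y) = y,
      forall x y : A, mul x (ldiv x y) = y,
      forall x y : A, rdiv (mul y x) x = y
    & forall x y : A, mul (rdiv y x) x = y].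

Definition is_loop (A : algebra) : Prop :=
  [/\ is_quasigroup A,
      forall x : A, mul (one A) x = x
    & forall x : A, mul x (one A) = x].

Definition finite_algebra (A : algebra) : Prop := finite_set [set: A].

Inductive term : Type :=
  | Var of nat
  | Mul of term & term
  | Ldiv of term & term
  | Rdiv of term & term
  | One.

Fixpoint eval (A : algebra) (v : nat -> A) (t : term) : A :=
  match t with
  | Var i => v i
  | Mul s t => mul (eval v s) (eval v t)
  | Ldiv s t => ldiv (eval v s) (eval v t)
  | Rdiv s t => rdiv (eval v s) (eval v t)
  | One => one A
  end.

Definition identity : Type := (term * term)%type.

Definition satisfies (A : algebra) (e : identity) : Prop :=
  forall v : nat -> A, eval v e.1 = eval v e.2.

Definition models (E : set identity) : set algebra :=
  [set A | forall e, E e -> satisfies A e].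

Definition is_variety (V : set algebra) : Prop :=
  exists E : set identity, V = models E.

Definition variety_gen (A : algebra) : set algebra := models (satisfies A).

Definition is_subvariety (W V : set algebra) : Prop :=
  is_variety W /\ W `<=` V.

Definition finitely_generated (V : set algebra) : Prop :=
  exists B : algebra, finite_algebra B /\ V = variety_gen B.

(* Main.v *)
Require Import Defs.
From HB Require Import structures.
From mathcomp Require Import all_boot order.
From mathcomp Require Import boolp classical_sets functions cardinality.

Set Implicit Arguments.
Unset Strict Implicit.
Unset Printing Implicit Defensive.

Import Order.Theory Defs.

Local Open Scope classical_set_scope.

(** Why every subvariety [W] of the variety of a finite loop [A] is finitely
    generated: the free algebra of [W] on [k] generators is finite, and for
    large [k] it satisfies no more identities than [W] does.

    The point is to bound the number of variables that are needed to recognise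
    the identities of [W].  An identity in [n] variables induces a pair of
    functions on the words of length [n] over [A].  Order these words
    lexicographically; a fork of a theory at the word [a] is the pair of values
    taken at [a] by an identity of the theory that holds in [A] at all words
    before [a].  Loops have a Mal'cev term, namely x (y \ z), and with its help
    a pair related by a larger theory can be repaired, one word after the other,
    into a pair related by a smaller one, provided that both theories have the
    same forks (lemmas [forks_separate] and [theory_of_forks]).

    Identifying and renaming variables transports a fork at a word to a fork at
    any word of which it is a dilation, that is, from which it arises by
    repeating letters that have already occurred ([fork_dilates]).  By Higman's
    lemma, dilation is a well-quasi-order on the words over a finite alphabet
    ([dilates_wqo]).  Hence there is a [k] such that every word at which a pair
    is not a fork of [W] dilates a word of length at most [k] at which it is not
    one either ([dilates_basis]).  As
    the free algebra on [k] generators has the same forks as [W] at the words of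
    length at most [k], it has the same forks as [W] altogether, and it
    generates [W] ([subvariety_finitely_generated]).

    Up to isomorphism there are only countably many finite algebras, since each
    is given by finite operation tables ([finite_algebra_code]); so there are
    only countably many finitely generated varieties. *)

(** * Infinite subsequences *)

Lemma frequently_subseq (P : nat -> Prop) :
  (forall n, exists2 m, n <= m & P m) ->
  exists2 e : nat -> nat, {homo e : i j / i < j} & forall i, P (e i).
Proof.
move=> freqP.
have /choice[f Hf] : forall n, exists m, n <= m /\ P m.
  by move=> n; have [m] := freqP n; exists m.
exists (fun i => iter i (fun k => f k.+1) (f 0)) => [|[|i] /=].
- by apply: homo_ltn ltn_trans _ => i /=; have [] := Hf (iter i (fun k => f k.+1) (f 0)).+1.
- by have [] := Hf 0.
- by have [] := Hf (iter i (fun k => f k.+1) (f 0)).+1.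
Qed.

Lemma constant_subseq (T : finType) (c : nat -> T) :
  exists x, exists2 e : nat -> nat, {homo e : i j / i < j} & forall i, c (e i) = x.
Proof.
suff [x freqx] : exists x, forall n, exists2 m, n <= m & c m = x.
  by exists x; apply: (@frequently_subseq (fun m => c m = x)).
apply: contrapT => /forallNP noFreq.
have /choice[N HN] : forall x, exists n, forall m, n <= m -> c m <> x.
  move=> x; have /existsNP[n Hn] := noFreq x.
  by exists n => m nm cm; apply: Hn; exists m.
exact: (HN _ (\max_x N x) (leq_bigmax (c (\max_x N x)))).
Qed.

(** * Higman's lemma *)

Definition bad (T : eqType) (f : nat -> seq T) : Prop :=
  forall i j, i < j -> ~~ subseq (f i) (f j).

(** The sequence is built one entry at a time: the n-th entry is the shortest
    one among all bad sequences that extend the entries already chosen.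
    Dependent choice runs over pairs of a length n and a bad sequence, of which
    only the first n entries are kept from then on. *)
Lemma minimal_bad (T : eqType) (f : nat -> seq T) : bad f ->
  exists2 g, bad g & forall n (h : nat -> seq T), bad h -> (forall i, i < n -> h i = g i) ->
    size (g n) <= size (h n).
Proof.
move=> bad_f.
have /choice[step Hstep] : forall p : nat * {h : nat -> seq T | bad h},
    exists g : {h : nat -> seq T | bad h},
      (forall i, i < p.1 -> sval g i = sval p.2 i) /\
      forall h : nat -> seq T, bad h -> (forall i, i < p.1 -> h i = sval p.2 i) ->
        size (sval g p.1) <= size (h p.1).
  move=> [n [g bad_g]] /=.
  pose Q k := `[< exists2 h : nat -> seq T, bad h &
    (forall i, i < n -> h i = g i) /\ size (h n) = k >].
  have exQ : exists k, Q k by exists (size (g n)); apply/asboolP; exists g.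
  case: (ex_minnP exQ) => k /asboolP[h bad_h [hg hk]] kmin.
  exists (exist _ h bad_h); split=> //= h' bad_h' h'g.
  by rewrite hk; apply: kmin; apply/asboolP; exists h'.
pose F := fix F n := step (n, if n is m.+1 then F m else exist _ f bad_f).
have FS n : F n.+1 = step (n.+1, F n) by [].
have F_stable m n : m <= n -> sval (F n) m = sval (F m) m.
  elim: n => [|n IHn]; first by case: m.
  rewrite leq_eqVlt => /predU1P[->//|]; rewrite ltnS => mn.
  by rewrite -IHn // FS; have [/(_ m mn)] := Hstep (n.+1, F n).
exists (fun n => sval (F n) n) => [i j ij|[|n] h bad_h hg].
- by rewrite -(F_stable i j (ltnW ij)); apply: (svalP (F j)).
- by have [_] := Hstep (0, exist _ f bad_f); apply.
- rewrite FS; have [_] := Hstep (n.+1, F n); apply=> // i lt_in.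
  by rewrite hg //= F_stable.
Qed.

(** Nash-Williams' argument.  In a minimal bad sequence [g], infinitely many
    entries begin with the same letter, as the alphabet is finite.  Keeping the
    entries that precede the first of these, and then continuing with those
    words deprived of their first letter, gives a bad sequence that is shorter
    at the place where it first differs from [g]. *)
Theorem higman (T : finType) (f : nat -> seq T) :
  exists i j, i < j /\ subseq (f i) (f j).
Proof.
apply: contrapT => good_f.
have /minimal_bad[g bad_g g_min] : bad f.
  by move=> i j ij; apply/negP => fij; apply: good_f; exists i, j.
have g_cons n : g n = oapp (cons^~ (behead (g n))) [::] (ohead (g n)).
  by case: (g n).
have [x [e e_mono ge]] := constant_subseq (fun n => ohead (g n)).
case: x ge => [x|] ge; last first.
  by have := bad_g _ _ (e_mono 0 1 isT); rewrite g_cons ge sub0seq.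
have {g_cons}ge i : g (e i) = x :: behead (g (e i)) by rewrite {1}g_cons ge.
(* The subtraction restarts the subsequence [e] at its first index. *)
pose h n := if n < e 0 then g n else behead (g (e (n - e 0))).
have bad_h : bad h.
  move=> i j ij; rewrite /h; case: ltnP => ie; case: ltnP => je.
  - exact: bad_g.
  - have e_ge k : e 0 <= e k by case: k => // k; apply/ltnW/e_mono.
    apply: contra (bad_g _ _ (leq_trans ie (e_ge (j - e 0)))) => sub.
    by rewrite (ge (j - e 0)); apply: subseq_trans sub (subseq_cons _ _).
  - by have := leq_ltn_trans ie ij; rewrite ltnNge (ltnW je).
  - have /bad_g : e (i - e 0) < e (j - e 0).
      by apply/e_mono/ltn_sub2r => //; apply: leq_ltn_trans ij.
    by rewrite [g (e (i - _))]ge [g (e (j - _))]ge /= eqxx.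
have := g_min (e 0) h bad_h (fun i lt_ie => ltac:(by rewrite /h lt_ie)).
by rewrite /h ltnn subnn {1}ge /= ltnn.
Qed.

(** * Dilations of words *)

(** [dilates a b]: reading from the last letter to the first, [b] comes from [a]
    by inserting letters that have already been read.  The insertions are made
    at the head because that is where lists grow; forks are attached to the
    reversed words. *)
Inductive dilates (T : eqType) : seq T -> seq T -> Prop :=
  | dilates_nil : dilates [::] [::]
  | dilates_match x a b : dilates a b -> dilates (x :: a) (x :: b)
  | dilates_skip x a b : x \in a -> dilates a b -> dilates a (x :: b).

(** The flag is [false] exactly at the position where the letter is read for the
    first time, reading from the end. *)
Fixpoint mark (T : eqType) (w : seq T) : seq (T * bool) :=
  if w is x :: w' then (x, x \in w') :: mark w' else [::].

Lemma mark_letters (T : eqType) (w : seq T) : map fst (mark w) = w.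
Proof. by elim: w => //= x w ->. Qed.

(** A subword embedding of marked words preserves first occurrences.  When both
    words use the same letters, every first occurrence in [b] is therefore hit,
    so that a letter of [b] which is not hit repeats a letter that was. *)
Lemma dilates_of_mark (T : eqType) (a b : seq T) :
  a =i b -> subseq (mark a) (mark b) -> dilates a b.
Proof.
elim: b a => [|y b IHb] [|x a] eq_ab.
- by move=> _; apply: dilates_nil.
- by [].
- by have := eq_ab y; rewrite in_cons eqxx.
rewrite /=; case: eqP => [[eq_xy eq_marks] sub|_ sub].
  rewrite eq_xy in eq_ab eq_marks *; apply/dilates_match/IHb => // z.
  have [->|z_neq] := eqVneq z y; first exact: eq_marks.
  by have := eq_ab z; rewrite !in_cons (negPf z_neq).
apply: dilates_skip; first by rewrite eq_ab mem_head.
apply: IHb => // z; apply/idP/idP => [z_a|z_b].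
  have /mem_subseq := map_subseq fst sub.
  by rewrite mark_letters; apply; rewrite /= mark_letters.
by rewrite eq_ab in_cons z_b orbT.
Qed.

(** Along a subsequence all words use the same letters, so that embeddings of
    marked words are dilations. *)
Lemma dilates_wqo (T : finType) (f : nat -> seq T) :
  exists i j, i < j /\ dilates (f i) (f j).
Proof.
have [c [e e_mono fe]] := constant_subseq (fun n => [set x in f n]%SET).
have [i [j [ij sub]]] := higman (fun n => mark (f (e n))).
exists (e i), (e j); split; first exact: e_mono.
apply: dilates_of_mark sub => x.
by have /setP/(_ x) := etrans (fe i) (esym (fe j)); rewrite !inE.
Qed.

(** A well-quasi-order leaves only finitely many minimal elements in any set of
    words; what matters below is that their lengths are bounded.  If no bound
    worked, one could choose words [c 0], [c 1], ... such that [c K] dilates no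
    member of [S] of length at most [K]; along indices that exceed the lengths
    of the previous choices this contradicts well-quasi-ordering. *)
Lemma dilates_basis (T : finType) (S : set (seq T)) :
  exists K, forall w, S w -> exists2 m, S m & size m <= K /\ dilates m w.
Proof.
apply: contrapT => /forallNP noK.
have /choice[c Hc] : forall K, exists w, S w /\
    forall m, S m -> size m <= K -> ~ dilates m w.
  move=> K; have /existsNP[w /not_implyP[Sw Hw]] := noK K.
  by exists w; split=> // m Sm mK mw; apply: Hw; exists m.
(* [k] is increasing and [size (c (k i)) <= k j] for all [i < j]. *)
pose k i := iter i (fun n => maxn n (size (c n))) 0.
have k_mono : {homo k : i j / i <= j}.
  by apply: homo_leq leqnn leq_trans _ => i; apply: leq_maxl.
have [i [j [ij]]] := dilates_wqo (fun i => c (k i)).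
have [Si _] := Hc (k i); have [_] := Hc (k j); apply=> //.
by apply: leq_trans (k_mono _ _ ij); apply: leq_maxr.
Qed.

(** A dilation is a renaming [f] of positions under which the first preimages of
    the positions of [rev a] come in increasing order. *)
Lemma dilates_rename (T : eqType) (x : T) (a b : seq T) : dilates a b ->
  exists f : nat -> nat,
    [/\ forall j, j < size b -> f j < size a,
        forall j, j < size b -> nth x (rev b) j = nth x (rev a) (f j)
      & forall i, i < size a ->
          exists2 k, k < size b & f k = i /\ forall j, j < k -> f j < i].
Proof.
elim=> {a b} [|y a b _ [f [f_lt f_nth f_first]]|y a b y_a _ [f [f_lt f_nth f_first]]].
- by exists id.
- exists (fun j => if j < size b then f j else size a); split=> [j|j|i] /=; rewrite ltnS.
  + by move=> _; case: ifP => // /f_lt/ltnW.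
  + rewrite !rev_cons !nth_rcons !size_rev leq_eqVlt => /predU1P[->|jb].
      by rewrite !ltnn !eqxx.
    by rewrite jb f_lt ?f_nth.
  + rewrite leq_eqVlt => /predU1P[->|ia].
      by exists (size b) => //; rewrite ltnn; split=> // j jb; rewrite jb f_lt.
    have [k kb [fk k_first]] := f_first i ia.
    exists k; first exact: ltnW.
    by rewrite kb; split=> // j jk; rewrite (ltn_trans jk kb) k_first.
- exists (fun j => if j < size b then f j else index y (rev a)).
  split=> [j|j|i] /=; rewrite ?ltnS.
  + by case: ifP => [/f_lt//|_ _]; rewrite -size_rev index_mem mem_rev.
  + rewrite rev_cons nth_rcons size_rev leq_eqVlt => /predU1P[->|jb].
      by rewrite ltnn eqxx nth_index ?mem_rev.
    by rewrite jb f_nth.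
  + move=> ia; have [k kb [fk k_first]] := f_first i ia.
    exists k; first exact: ltnW.
    by rewrite kb; split=> // j jk; rewrite (ltn_trans jk kb) k_first.
Qed.

(** * Terms, substitutions and equational theories *)

Fixpoint subst (f : nat -> term) (t : term) : term :=
  match t with
  | Var i => f i
  | Mul s t => Mul (subst f s) (subst f t)
  | Ldiv s t => Ldiv (subst f s) (subst f t)
  | Rdiv s t => Rdiv (subst f s) (subst f t)
  | One => One
  end.

Lemma eval_subst (A : algebra) (v : nat -> A) f t :
  eval v (subst f t) = eval (fun i => eval v (f i)) t.
Proof. by elim: t => //= [s -> t ->|s -> t ->|s -> t ->]. Qed.

(** Forces a term into the first [n] variables.  The unit replaces the other
    variables, in accordance with [word_eval] below, where it is the default
    value for the positions beyond the end of a word. *)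
Definition truncate n : term -> term :=
  subst (fun i => if i < n then Var i else One).

Lemma eval_truncate (A : algebra) (v : nat -> A) n t :
  eval v (truncate n t) = eval (fun i => if i < n then v i else one A) t.
Proof. by rewrite eval_subst; congr eval; apply/funext => i; case: ifP. Qed.

Lemma truncate_id t : exists n, forall m, n <= m -> truncate m t = t.
Proof.
elim: t => [i|s [n1 s_id] t [n2 t_id]|s [n1 s_id] t [n2 t_id]|s [n1 s_id] t [n2 t_id]|].
1: by exists i.+1 => m im; rewrite /truncate /= im.
4: by exists 0.
all: exists (maxn n1 n2) => m; rewrite geq_max => /andP[m1 m2].
all: by rewrite /truncate /= -!/(truncate _ _) s_id ?t_id.
Qed.

Definition theory (W : set algebra) : set identity :=
  [set e | forall B, W B -> satisfies B e].

Lemma theory_subst (W : set algebra) f s t :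
  theory W (s, t) -> theory W (subst f s, subst f t).
Proof. by move=> st B WB v /=; rewrite !eval_subst; apply: (st B WB). Qed.

(** * Forks determine a congruence *)

(** Terms act on a finite totally ordered set of points through [ev].  Given
    [R' s t], one repairs [s] inside its [R]-class until it agrees with [t]
    everywhere.  At the first point [i] of disagreement, the pair of values of
    [s] and [t] is a fork of [R'], hence is realised by an [R]-related pair
    [s', t'] that agrees below [i]; the Mal'cev operation applied to
    [s, s', t'] leaves the values of [s] below [i] unchanged and moves its value
    at [i] to that of [t].  [D s] consists of the points from the first
    disagreement on, and shrinks at every step. *)
Lemma forks_separate (d : Order.disp_t) (I : finOrderType d) (T : Type) (X : eqType)
    (ev : T -> I -> X) (R R' : T -> T -> Prop) :
  (forall s t, ev s =1 ev t -> R s t) ->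
  (forall s h t, R s h -> R h t -> R s t) ->
  (forall s h t, R s h -> R' s t -> R' h t) ->
  (forall h s t, R s t -> exists2 h', R h h' & forall i,
    (ev s i = ev t i -> ev h' i = ev h i) /\ (ev s i = ev h i -> ev h' i = ev t i)) ->
  (forall i s t, R' s t -> (forall j, (j < i)%O -> ev s j = ev t j) ->
    exists s' t', [/\ R s' t', forall j, (j < i)%O -> ev s' j = ev t' j,
      ev s' i = ev s i & ev t' i = ev t i]) ->
  forall s t, R' s t -> R s t.
Proof.
move=> R_ev R_trans R_R' maltsev fork s t.
pose D s := [set a | [exists c, (c <= a)%O && (ev s c != ev t c)]]%SET.
have [m] := ubnP #|D s|; elim: m s => // m IHm s lt_Dm R'st.
have [/forallP eq_st|/forallPn[i0 neq0]] := boolP [forall i, ev s i == ev t i].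
  by apply: R_ev => i; apply/eqP.
case: (arg_minP id (P := [pred i | ev s i != ev t i]) neq0) => /= i neq_i i_min.
have below j : (j < i)%O -> ev s j = ev t j.
  move=> ji; apply/eqP; apply: contraTT ji => /i_min.
  by rewrite -leNgt.
have [s' [t' [Rst' below' s'i t'i]]] := fork i s t R'st below.
have [h Rsh Hh] := maltsev s s' t' Rst'.
have ht j : (j <= i)%O -> ev h j = ev t j.
  rewrite le_eqVlt => /predU1P[->|ji].
    by have [_ ->] := Hh i.
  by have [-> //] := Hh j; rewrite ?below ?below'.
apply: R_trans (Rsh) (IHm h _ (R_R' _ _ _ Rsh R'st)).
suff lt_hs : #|D h| < #|D s| by rewrite (leq_trans lt_hs) // -ltnS.
apply: proper_card; apply/properP; split.
  apply/fintype.subsetP => a; rewrite !inE => /existsP[c /andP[ca neq_c]].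
  apply/existsP; exists i; rewrite neq_i andbT.
  apply: le_trans ca; rewrite leNgt; apply: contra neq_c => /ltW/ht->.
  by [].
exists i; rewrite !inE; first by apply/existsP; exists i; rewrite lexx neq_i.
by apply/existsPn => c; apply/nandP; case: leP => [/ht->|]; rewrite ?eqxx; [right|left].
Qed.

(** * The lexicographic order *)

(** The order of [tuplelexi] on words of equal length, stated for sequences so
    that words whose lengths are not known to be convertible can be compared. *)
Definition lexlt (d : Order.disp_t) (T : porderType d) (x : T) (c a : seq T) : Prop :=
  exists2 i, i < size a &
    (forall j, j < i -> nth x c j = nth x a j) /\ (nth x c i < nth x a i)%O.

Lemma lexltP (d : Order.disp_t) (T : porderType d) (x : T) n (c a : n.-tuplelexi T) :
  (c < a)%O <-> lexlt x c a.
Proof.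
split=> [/ltxi_tupleP[k Hk]|[i]].
  exists k; first by rewrite size_tuple.
  split=> [j jk|].
    have jn := ltn_trans jk (ltn_ord k).
    have [_] := Hk (Ordinal jn) (ltnW jk).
    by rewrite !(tnth_nth x) /= (ltn_eqF jk) => /eqP.
  by rewrite -!tnth_nth (lt_leif (Hk k (leqnn k))) eqxx.
rewrite size_tuple => lt_in [eq_ca lt_ca]; apply/ltxi_tupleP.
exists (Ordinal lt_in) => j /=; rewrite !(tnth_nth x) leq_eqVlt => /predU1P[->|ji].
  by rewrite eqxx; split; [apply: ltW|rewrite (lt_eqF lt_ca)].
by rewrite eq_ca //; split; rewrite ?lexx // eqxx (ltn_eqF ji).
Qed.

(** * Finite algebras on standard carriers *)

(** A copy of the ordinals below [q] that lives in [Set], so that it can be the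
    carrier of an [algebra]: the universe of [ordinal] is too large for that. *)
Record letter (q : nat) : Set := Letter { letter_val : nat; letter_lt : letter_val < q }.

HB.instance Definition _ q := [isSub for @letter_val q].
HB.instance Definition _ q := [Countable of letter q by <:].

Definition ord_of_letter q (i : letter q) : 'I_q := Ordinal (letter_lt i).
Definition letter_of_ord q (i : 'I_q) : letter q := Letter (ltn_ord i).

Lemma ord_of_letterK q : cancel (@ord_of_letter q) (@letter_of_ord q).
Proof. by move=> i; apply: val_inj. Qed.

HB.instance Definition _ q : isFinite (letter q) := CanIsFinite (@ord_of_letterK q).
HB.instance Definition _ q :=
  [SubChoice_isSubOrder of letter q by <: with Order.OrdinalOrder.ord_display].

Definition code : Type :=
  {q : nat & ({ffun letter q * letter q -> letter q} * {ffun letter q * letter q -> letter q} *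
              {ffun letter q * letter q -> letter q} * letter q)%type}.

Definition decode (c : code) : algebra :=
  @Algebra (letter (tag c))
    (fun x y => (tagged c).1.1.1 (x, y)) (fun x y => (tagged c).1.1.2 (x, y))
    (fun x y => (tagged c).1.2 (x, y)) (tagged c).2.

(** * Forks of a theory at a word *)

Definition word_eval (A : algebra) (w : seq A) (t : term) : A :=
  eval (nth (one A) w) t.

Lemma word_eval_truncate (A : algebra) (w : seq A) n t :
  size w <= n -> word_eval w (truncate n t) = word_eval w t.
Proof.
move=> wn; rewrite /word_eval eval_truncate; congr eval; apply/funext => i.
by case: ltnP => // ni; rewrite nth_default // (leq_trans wn).
Qed.

Lemma eval_truncate_word (A : algebra) (v : nat -> A) n t :
  eval v (truncate n t) = word_eval (mkseq v n) t.
Proof.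
rewrite eval_truncate /word_eval; congr eval; apply/funext => i.
by case: ltnP => ni; [rewrite nth_mkseq|rewrite nth_default ?size_mkseq].
Qed.

(** The pair [u] is a fork of the identities of [W] at the word [a] when some
    identity of [W] takes the values [u] at [a] in the coded algebra, while it
    holds there at all words of the same length that precede [a]
    lexicographically. *)
Definition fork (c : code) (W : set algebra) (a : seq (letter (tag c)))
    (u : letter (tag c) * letter (tag c)) : Prop :=
  exists s t, [/\ theory W (s, t),
    forall b : seq (letter (tag c)), size b = size a -> lexlt (one (decode c)) b a ->
      word_eval (A := decode c) b s = word_eval (A := decode c) b t,
    word_eval (A := decode c) a s = u.1 & word_eval (A := decode c) a t = u.2].

(** Renaming the variables along [f] pulls a word [w] back to the word
    [pull w] with letters [w (f j)].  This sends [rev a] to [rev b], and it is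
    strictly monotone below [rev a]: if [w] first differs from [rev a] at the
    position [i], then [pull w] first differs from [rev b] at the first preimage
    of [i], because all earlier positions are sent below [i]. *)
Lemma fork_dilates (c : code) (W : set algebra) (a b : seq (letter (tag c))) u :
  dilates a b -> fork W (rev b) u -> fork W (rev a) u.
Proof.
move=> /(dilates_rename (one (decode c)))[f [f_lt f_nth f_first]] [s [t [st below s_b t_b]]].
pose pull w : seq (decode c) := mkseq (fun j => nth (one (decode c)) w (f j)) (size b).
pose f_subst := subst (fun j => if j < size b then Var (f j) else One).
have eval_pull w r : word_eval w (f_subst r) = word_eval (pull w) r.
  rewrite /word_eval eval_subst; congr eval; apply/funext => j.
  by case: ltnP => jb; [rewrite nth_mkseq|rewrite nth_default ?size_mkseq].
have pull_a : pull (rev a) = rev b.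
  apply: (@eq_from_nth _ (one (decode c))); rewrite size_mkseq ?size_rev // => j jb.
  by rewrite nth_mkseq ?f_nth.
exists (f_subst s), (f_subst t).
split; rewrite ?eval_pull ?pull_a //; first exact: theory_subst.
move=> w _ [i]; rewrite size_rev => ia [w_eq w_lt]; rewrite !eval_pull.
apply: below; first by rewrite size_mkseq size_rev.
have [k kb [fk k_first]] := f_first i ia.
exists k; first by rewrite size_rev.
split=> [j jk|]; last by rewrite nth_mkseq // f_nth // fk.
by rewrite nth_mkseq ?f_nth ?w_eq ?k_first // (ltn_trans jk kb).
Qed.

(** * Mal'cev terms *)

Definition maltsev_term (A : algebra) (p : term) : Prop :=
  satisfies A (subst (nth One [:: Var 0; Var 1; Var 1]) p, Var 0) /\
  satisfies A (subst (nth One [:: Var 0; Var 0; Var 1]) p, Var 1).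

Lemma eval_subst3 (A : algebra) (v : nat -> A) p r s t :
  eval v (subst (nth One [:: r; s; t]) p) =
  eval (nth (one A) [:: eval v r; eval v s; eval v t]) p.
Proof. by rewrite eval_subst; congr eval; apply/funext => -[|[|[|[|i]]]]. Qed.

Lemma maltsev_right (A : algebra) p (x y : A) :
  maltsev_term A p -> eval (nth (one A) [:: x; y; y]) p = x.
Proof. by case=> /(_ (nth (one A) [:: x; y])); rewrite eval_subst3. Qed.

Lemma maltsev_left (A : algebra) p (x y : A) :
  maltsev_term A p -> eval (nth (one A) [:: x; x; y]) p = y.
Proof. by case=> _ /(_ (nth (one A) [:: x; y])); rewrite eval_subst3. Qed.

(** Forks at words of length [n] control the identities in [n] variables, and
    every identity involves finitely many variables. *)
Lemma theory_of_forks (c : code) p (W W' : set algebra) :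
  maltsev_term (decode c) p ->
  W `<=` variety_gen (decode c) ->
  theory W `<=` theory W' ->
  (forall a u, fork (c := c) W' a u -> fork W a u) ->
  theory W' `<=` theory W.
Proof.
move=> p_maltsev WA WW' forks [s0 t0] st0.
have [n1 Hs] := truncate_id s0; have [n2 Ht] := truncate_id t0.
pose n := maxn n1 n2; rewrite -(Hs n (leq_maxl _ _)) -(Ht n (leq_maxr _ _)).
pose ev s (w : n.-tuplelexi (letter (tag c))) := word_eval (A := decode c) w s.
apply: (@forks_separate _ _ _ _ ev (fun s t => theory W (truncate n s, truncate n t))
  (fun s t => theory W' (truncate n s, truncate n t))) (theory_subst _ st0).
- move=> s t st X WX; apply: (WA X WX) => v /=.
  rewrite !eval_truncate_word.
  by have /= := st [tuple of mkseq v n].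
- by move=> s h t sh ht X WX v /=; rewrite (sh X WX) (ht X WX).
- by move=> s h t /WW' sh st X WX v /=; rewrite -(sh X WX) (st X WX).
- move=> h s t st; exists (subst (nth One [:: h; s; t]) p) => [X WX v /=|i].
    rewrite [RHS]eval_truncate eval_subst3 -!eval_truncate (st X WX) /=.
    by rewrite maltsev_right //; split; apply: (WA X WX); case: p_maltsev.
  rewrite /ev /word_eval eval_subst3.
  split=> eq_i; rewrite eq_i; first exact: (maltsev_right _ _ p_maltsev).
  exact: (maltsev_left _ _ p_maltsev).
- move=> i s t st below.
  have [|s' [t' [st' below' s'i t'i]]] := forks i (ev s i, ev t i).
    exists (truncate n s), (truncate n t); split=> //.
    + move=> b; rewrite size_tuple => sz_b lt_bi.
      rewrite !word_eval_truncate ?sz_b //.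
      have sz_b' : size b == n by rewrite sz_b.
      exact/(below (Tuple sz_b'))/lexltP/lt_bi.
    + by rewrite word_eval_truncate ?size_tuple.
    + by rewrite word_eval_truncate ?size_tuple.
  exists s', t'; split=> //; first exact: theory_subst.
  by move=> j /(@lexltP _ (letter (tag c)) (one (decode c))) ji; apply: below'; rewrite ?size_tuple.
Qed.

(** * Relatively free algebras *)

HB.instance Definition _ := gen_eqMixin term.
HB.instance Definition _ := gen_choiceMixin term.

(** The chosen representative depends on the class of [t] alone, since [xget]
    depends on its predicate alone; hence the terms fixed by [canon W n] stand
    for the quotient of the terms by the [n]-variable identities of [W]. *)
Definition canon (W : set algebra) n (t : term) : term :=
  xget One [set s | theory W (truncate n s, truncate n t)].

Lemma canonP (W : set algebra) n t : theory W (truncate n (canon W n t), truncate n t).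
Proof.
have : [set s | theory W (truncate n s, truncate n t)] (canon W n t); last by [].
by apply: xgetPex; exists t.
Qed.

Lemma canon_eq (W : set algebra) n s t :
  canon W n s = canon W n t <-> theory W (truncate n s, truncate n t).
Proof.
split=> [eq_st X WX v /=|st].
  by have /= <- := canonP n s WX v; rewrite eq_st; apply: (canonP n t WX v).
congr xget; apply/funext => r; apply/propext; split=> rs X WX v /=.
  by rewrite (rs X WX v) (st X WX v).
by rewrite (rs X WX v) (st X WX v).
Qed.

Lemma canonK (W : set algebra) n t : canon W n (canon W n t) = canon W n t.
Proof. exact/canon_eq/canonP. Qed.

Definition free_class (W : set algebra) n t : {t | canon W n t = t} :=
  exist _ (canon W n t) (canonK W n t).

(** The free algebra of the variety generated by [W] on the first [n]
    variables. *)
Definition free (W : set algebra) n : algebra :=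
  @Algebra {t | canon W n t = t}
    (fun x y => free_class W n (Mul (sval x) (sval y)))
    (fun x y => free_class W n (Ldiv (sval x) (sval y)))
    (fun x y => free_class W n (Rdiv (sval x) (sval y)))
    (free_class W n One).

Lemma free_class_eq (W : set algebra) n s t :
  free_class W n s = free_class W n t <-> theory W (truncate n s, truncate n t).
Proof.
rewrite -canon_eq; split=> [/(congr1 sval)//|st].
exact: eq_exist.
Qed.

Lemma eval_free (W : set algebra) n (v : nat -> free W n) t :
  eval v t = free_class W n (subst (fun i => sval (v i)) t).
Proof.
elim: t => /= [i|s -> t ->|s -> t ->|s -> t ->|//].
  by case: (v i) => t canon_t; apply: eq_exist; rewrite /= canon_t.
all: apply/free_class_eq => X WX w /=.
all: by rewrite (canonP n _ WX) (canonP n _ WX).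
Qed.

Lemma free_models (W : set algebra) n : models (theory W) (free W n).
Proof.
move=> [s t] st v /=; rewrite !eval_free; apply/free_class_eq.
exact/theory_subst/theory_subst.
Qed.

(** An identity of the free algebra holds at its generators, the classes of the
    variables. *)
Lemma free_identity (W : set algebra) n s t :
  satisfies (free W n) (s, t) -> theory W (truncate n s, truncate n t).
Proof.
move=> /(_ (fun i => free_class W n (Var i))) /=; rewrite !eval_free.
move=> /free_class_eq st X WX v /=.
have generic r : eval v (truncate n r) =
    eval v (truncate n (subst (fun i => canon W n (Var i)) r)).
  rewrite /truncate !eval_subst; congr eval; apply/funext => i.
  by have /= := canonP n (Var i) WX v; rewrite /truncate eval_subst /= => <-.
by rewrite generic (generic t); apply: st.
Qed.

(** Elements are separated by the [n]-ary functions that they induce on the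
    finite algebra, as [W] satisfies all its identities. *)
Lemma free_finite (c : code) (W : set algebra) n :
  W `<=` variety_gen (decode c) -> finite_algebra (free W n).
Proof.
move=> WA.
pose F (x : free W n) : {ffun n.-tuple (letter (tag c)) -> letter (tag c)} :=
  [ffun w => word_eval (A := decode c) (tval w) (sval x)].
suff F_inj : injective F.
  rewrite /finite_algebra -(preimage_setT F).
  apply: finite_preimage => [x y _ _|]; [exact: F_inj|exact: finite_finset].
move=> [s canon_s] [t canon_t] /ffunP Fst; apply: eq_exist.
rewrite -canon_s -canon_t; apply/canon_eq => X WX.
apply: (WA X WX) => v; rewrite /= !eval_truncate_word.
by have := Fst [tuple of mkseq v n]; rewrite !ffunE.
Qed.

(** * Subvarieties of a finitely generated variety with a Mal'cev term *)

(** For each of the finitely many pairs [u], the words at which [u] is not a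
    fork of [W] all dilate such a word of length at most [k].  The free algebra
    [B] on [k] generators satisfies the same [k]-variable identities as [W], so
    it has the same forks at words of length at most [k].  A fork of [B] that is
    not a fork of [W] would be inherited from a long word by a short one, where
    [B] and [W] cannot differ. *)
Lemma subvariety_finitely_generated (c : code) p (W : set algebra) :
  maltsev_term (decode c) p ->
  is_subvariety W (variety_gen (decode c)) -> finitely_generated W.
Proof.
move=> p_maltsev [[E WE] WA].
have W_models : W = models (theory W).
  apply/seteqP; split=> [X WX e|X modX]; first exact.
  by rewrite WE => e Ee; apply: modX => B; rewrite WE; apply.
have /choice[K HK] := fun u => dilates_basis [set w | ~ fork (c := c) W (rev w) u].
pose k := \max_u K u; pose B := free W k.
have theoryB : theory [set B] = satisfies B.
  by apply/seteqP; split=> e; [apply|move=> Be _ ->].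
exists B; split; first exact: free_finite WA.
rewrite /variety_gen W_models; congr models.
apply/seteqP; split=> [e We|]; first exact: free_models.
rewrite -theoryB; apply: theory_of_forks p_maltsev WA _ _ => [e We _ ->|a u].
  exact: free_models.
rewrite -(revK a); move: (rev a) => {}a fork_a; apply: contrapT => no_fork.
have [m no_fork_m [size_m dil_m]] := HK u a no_fork.
apply: no_fork_m.
have [s [t []]] := fork_dilates dil_m fork_a.
rewrite theoryB => st below s_m t_m.
have le_mk : size m <= k by apply: leq_trans size_m (leq_bigmax u).
exists (truncate k s), (truncate k t).
split; rewrite ?word_eval_truncate ?size_rev //; first exact: free_identity.
by move=> b sz_b lt_b; rewrite !word_eval_truncate ?sz_b //; apply: below; rewrite ?size_rev.
Qed.

(** * Coding finite algebras *)

Lemma satisfies_iso (A B : algebra) (f : A -> B) (g : B -> A) :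
  cancel f g -> cancel g f ->
  {morph f : x y / mul x y} -> {morph f : x y / ldiv x y} ->
  {morph f : x y / rdiv x y} -> f (one A) = one B ->
  satisfies A = satisfies B.
Proof.
move=> fK gK f_mul f_ldiv f_rdiv f_one.
have f_eval v t : f (eval v t) = eval (f \o v) t.
  by elim: t => //= [s <- t <-|s <- t <-|s <- t <-].
apply/funext => -[s t]; apply/propext; split=> st v /=.
  have -> : v = f \o (g \o v) by apply/funext => i /=; rewrite gK.
  by rewrite -!f_eval (st _).
by apply: (can_inj fK); rewrite !f_eval; apply: st.
Qed.

Lemma finite_algebra_code (A : algebra) : finite_algebra A ->
  exists c : code, satisfies A = satisfies (decode c).
Proof.
move=> /finite_setP[q /card_set_bijP[r [r_lt r_inj r_surj]]].
have lt_rq x : r x < q by apply: r_lt.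
pose f x : letter q := Letter (lt_rq x).
have f_inj : injective f.
  by move=> x y /(congr1 val)/= rxy; apply: r_inj; rewrite ?inE.
have /choice[g gK] : forall i : letter q, exists x, f x = i.
  by move=> i; have [x _ rx] := r_surj _ (letter_lt i); exists x; apply: val_inj.
have fK : cancel f g by move=> x; apply: f_inj; rewrite gK.
pose table op : {ffun letter q * letter q -> letter q} := [ffun u => f (op (g u.1) (g u.2))].
pose c : code := existT _ q (table (@mul A), table (@ldiv A), table (@rdiv A), f (one A)).
exists c; apply: (@satisfies_iso A (decode c) f g fK gK) => // x y;
  by rewrite /= ffunE !fK.
Qed.

Theorem corollary1p4 (A : algebra) (A_loop : is_loop A)
    (A_finite : finite_algebra A) :
  countable [set W | is_subvariety W (variety_gen A)] /\
  (forall W : set algebra,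
     is_subvariety W (variety_gen A) -> finitely_generated W).
Proof.
have fg W : is_subvariety W (variety_gen A) -> finitely_generated W.
  have [c sat_c] := finite_algebra_code A_finite.
  rewrite /variety_gen sat_c.
  (* x (y \ z) is a Mal'cev term: y \ y is the unit. *)
  apply: (@subvariety_finitely_generated c (Mul (Var 0) (Ldiv (Var 1) (Var 2)))).
  have [[ldivK mulKl _ _] _ mul_one] := A_loop.
  split; rewrite -sat_c => v /=; last exact: mulKl.
  by rewrite -{2}(mul_one (v 1)) ldivK mul_one.
split=> //.
have sub : [set W | is_subvariety W (variety_gen A)] `<=`
    range (fun c => variety_gen (decode c)).
  move=> W /fg[B [B_finite ->]].
  have [c sat_c] := finite_algebra_code B_finite.
  by exists c => //; rewrite /variety_gen sat_c.
apply: sub_countable (subset_card_le sub) _.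
exact: sub_countable (card_image_le _ _) (countableP _).
Qed.
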